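(* A domain $\Omega=\{r<0\}\subset\mathbb{C}^2$ has a local plurisubharmonic defining function in a neighborhood of $p\in b\Omega$ if and only if there exist a function $T:\mathbb{C}^2\to\mathbb{R}$ and a constant $C>0$ such that $$-\mathcal{H}_{(1+T)r}\le C\,\mathcal{L}_r$$ in a neighborhood of $p$, where the plurisubharmonicity and the inequality are both understood at the points of the boundary $b\Omega$ near $p$.
   Context: Coordinates on $\mathbb{C}^2$ are $(z,w)$, and subscripts denote partial derivatives, e.g. $r_z=\partial r/\partial z$, $r_{z\bar w}=\partial^2 r/\partial z\,\partial\bar w$. A real-valued function $r$ is a defining function for $\Omega$ if $\Omega=\{(z,w)\in\mathbb{C}^2: r(z,w)<0\}$ and $\nabla r\neq 0$ on the boundary $b\Omega$. By rotation, translation and the implicit function theorem it is assumed that $p$ is the origin and $r=\operatorname{Im} w+F(z,\bar z,\operatorname{Re} w,\operatorname{Im} w)$ with the terms in $F$ of degree at least $2$, so that $r_w\neq0$ near $p$. The Levi form, evaluated on the complex tangent vector $\langle r_w,-r_z\rangle$, is $$\mathcal{L}_r=r_{z\bar z}|r_w|^2+r_{w\bar w}|r_z|^2-2\operatorname{Re}[r_{z\bar w}r_wr_{\bar z}].$$ For a real-valued function $f$, $\mathcal{H}_f=f_{z\bar z}f_{w\bar w}-|f_{z\bar w}|^2$ is the determinant of the complex Hessian matrix of $f$. A function is plurisubharmonic if its complex Hessian matrix is positive semidefinite on all vectors of $\mathbb{C}^2$. These notions are used in local form, being required only on a neighborhood of $p$ inside the boundary: a local plurisubharmonic defining function near $p$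 is a local defining function $\rho$ for $\Omega$ near $p$ whose complex Hessian matrix is positive semidefinite at every point of $b\Omega$ in some neighborhood of $p$. Such a $\rho$ can be written $\rho=r\cdot h$ with $h$ a real-valued multiplier function that does not vanish in a neighborhood of $p$.
   Formalization: The formal theorem assumes Levi pseudoconvexity (L_r ≥ 0 on the boundary near p), without which ''if'' fails (exterior of a ball, T = 0), and requires 1+T non-vanishing near p, since T = -1 would be trivial; r, T and the defining functions are taken smooth near p. *)

(* Defs.v *)
From Stdlib Require Import Reals.
From Coquelicot Require Import Coquelicot.
Open Scope R_scope.

(** Points [(z, w)] of C^2; the topology is Coquelicot's product topology. *)
Definition C2 : Type := (C * C)%type.

Inductive coord : Set := ReZ | ImZ | ReW | ImW.

Definition axis (c : coord) : C2 :=
  match c with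
  | ReZ => (RtoC 1, RtoC 0)
  | ImZ => (Ci, RtoC 0)
  | ReW => (RtoC 0, RtoC 1)
  | ImW => (RtoC 0, Ci)
  end.

Definition translate (x v : C2) (t : R) : C2 :=
  ((fst x + t * fst v)%C, (snd x + t * snd v)%C).

Definition ex_pd (c : coord) (f : C2 -> R) (x : C2) : Prop :=
  ex_derive (fun t : R => f (translate x (axis c) t)) 0.

Definition pd (c : coord) (f : C2 -> R) (x : C2) : R :=
  Derive (fun t : R => f (translate x (axis c) t)) 0.

Fixpoint Ck_on (k : nat) (U : C2 -> Prop) (f : C2 -> R) : Prop :=
  (forall x : C2, U x -> continuous (f : C * C -> R) x) /\
  match k with
  | O => True
  | S j => forall c : coord,
      (forall x : C2, U x -> ex_pd c f x) /\ Ck_on j U (pd c f)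
  end.

Definition smooth_near (f : C2 -> R) (p : C2) : Prop :=
  exists U : C2 -> Prop,
    open (U : C * C -> Prop) /\ U p /\ forall k : nat, Ck_on k U f.

Definition grad (f : C2 -> R) (x : C2) : R * R * R * R :=
  (pd ReZ f x, pd ImZ f x, pd ReW f x, pd ImW f x).

Definition pdC (c : coord) (f : C2 -> C) (x : C2) : C :=
  (pd c (fun y => Re (f y)) x, pd c (fun y => Im (f y)) x).

Definition d_z (f : C2 -> C) (x : C2) : C :=
  ((pdC ReZ f x - Ci * pdC ImZ f x) / 2)%C.
Definition d_zbar (f : C2 -> C) (x : C2) : C :=
  ((pdC ReZ f x + Ci * pdC ImZ f x) / 2)%C.
Definition d_w (f : C2 -> C) (x : C2) : C :=
  ((pdC ReW f x - Ci * pdC ImW f x) / 2)%C.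
Definition d_wbar (f : C2 -> C) (x : C2) : C :=
  ((pdC ReW f x + Ci * pdC ImW f x) / 2)%C.

Definition toC (f : C2 -> R) : C2 -> C := fun x => RtoC (f x).

(** [d_zbar (d_z f)] is [f_{z zbar}], etc.  For smooth real [r], [f_{z zbar}]
    and [f_{w wbar}] are real, so [Re] only converts the type; likewise in
    [hessian_det]. *)
Definition levi (r : C2 -> R) (x : C2) : R :=
  let f := toC r in
  Re (d_zbar (d_z f) x) * (Cmod (d_w f x)) ^ 2
  + Re (d_wbar (d_w f) x) * (Cmod (d_z f x)) ^ 2
  - 2 * Re (d_wbar (d_z f) x * d_w f x * d_zbar f x)%C.

Definition hessian_det (r : C2 -> R) (x : C2) : R :=
  let f := toC r in
  Re (d_zbar (d_z f) x) * Re (d_wbar (d_w f) x)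
  - (Cmod (d_wbar (d_z f) x)) ^ 2.

(** The value is real for smooth real [r]. *)
Definition hessian_form (r : C2 -> R) (x : C2) (a b : C) : C :=
  let f := toC r in
  (d_zbar (d_z f) x * a * Cconj a + d_wbar (d_z f) x * a * Cconj b
   + d_zbar (d_w f) x * b * Cconj a + d_wbar (d_w f) x * b * Cconj b)%C.

Definition hessian_psd (r : C2 -> R) (x : C2) : Prop :=
  forall a b : C, 0 <= Re (hessian_form r x a b).

Definition near (p : C2) (P : C2 -> Prop) : Prop :=
  locally (p : C * C) (P : C * C -> Prop).

Definition boundary (Omega : C2 -> Prop) (x : C2) : Prop :=
  forall U : C2 -> Prop, near x U ->
    (exists y, U y /\ Omega y) /\ (exists y, U y /\ ~ Omega y).

Definition is_domain (Omega : C2 -> Prop) : Prop :=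
  open (Omega : C * C -> Prop) /\
  (exists x, Omega x) /\
  forall U V : C2 -> Prop,
    open (U : C * C -> Prop) -> open (V : C * C -> Prop) ->
    (forall x, Omega x -> U x \/ V x) ->
    (exists x, Omega x /\ U x) -> (exists x, Omega x /\ V x) ->
    exists x, Omega x /\ U x /\ V x.

Definition defining_function (Omega : C2 -> Prop) (r : C2 -> R) : Prop :=
  (forall x, Omega x <-> r x < 0) /\
  (forall x, boundary Omega x ->
     smooth_near r x /\ grad r x <> (0, 0, 0, 0)).

Definition local_defining_function
    (Omega : C2 -> Prop) (p : C2) (rho : C2 -> R) : Prop :=
  smooth_near rho p /\
  near p (fun x => Omega x <-> rho x < 0) /\
  near p (fun x => boundary Omega x -> grad rho x <> (0, 0, 0, 0)).

Definition local_psh_defining_function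
    (Omega : C2 -> Prop) (p : C2) (rho : C2 -> R) : Prop :=
  local_defining_function Omega p rho /\
  near p (fun x => boundary Omega x -> hessian_psd rho x).

(** Levi pseudoconvexity of [{r < 0}] at the boundary points near [p]. *)
Definition pseudoconvex_near
    (Omega : C2 -> Prop) (r : C2 -> R) (p : C2) : Prop :=
  near p (fun x => boundary Omega x -> 0 <= levi r x).

(* Main.v *)
Require Import Defs.
From Stdlib Require Import Reals Lra Psatz FunctionalExtensionality.
From Coquelicot Require Import Coquelicot.
Open Scope R_scope.

(** Everything depends on how the Hessian of h r at points of {r = 0} varies
    with the multiplier h.

    If -H_{hr} <= K L_r with h > 0, then M r^2 is added to h r. At boundary
    points this raises the determinant of the complex Hessian by 2 M h L_r and
    its trace by M |grad r|^2 / 2 ([hessian_add_square]). Since L_r >= 0, a large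
    M makes both nonnegative near p, and a Hermitian 2 x 2 matrix with
    nonnegative determinant and trace is positive semidefinite
    ([psh_from_hessian_bound]). If h < 0, the determinant is that of (-h) r.

    Conversely a plurisubharmonic defining function rho has H_rho >= 0, so
    -H_rho <= L_r by pseudoconvexity, and it remains to write rho as h r. Only
    the derivatives of rho up to order two at boundary points matter, so it is
    enough that h r and rho have the same 2-jets there. An h with this property
    is given by an explicit formula in the derivatives of r and rho
    ([jet_factorization]); its smoothness needs no division theorem. The formula
    works because a function that vanishes on {r = 0} has its gradient parallel
    to that of r ([gradients_parallel]), which is applied to rho and then to the
    first derivatives of a remainder. *)

(** * Restriction to coordinate lines and planes *)

Lemma translate_0 : forall x v, translate x v 0 = x.
Proof. intros [x1 x2] v. unfold translate; simpl. f_equal; ring. Qed.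

Lemma translate_add : forall x v s t,
  translate (translate x v s) v t = translate x v (s + t).
Proof.
  intros x v s t. unfold translate; simpl. rewrite RtoC_plus. f_equal; ring.
Qed.

Lemma translate_comm : forall x v u s t,
  translate (translate x v s) u t = translate (translate x u t) v s.
Proof. intros x v u s t. unfold translate; simpl. f_equal; ring. Qed.

Lemma ball_translate : forall (x : C2) c t (e : R), Rabs t < e ->
  ball (x : C * C) e (translate x (axis c) t : C * C).
Proof.
  intros [[a b] [d g]] c t e H.
  assert (H0 : 0 < e) by (pose proof (Rabs_pos t); lra).
  assert (K : forall u v, v = u \/ v = u + t -> Rabs (v + - u) < e).
  { intros u v [-> | ->].
    - replace (u + - u) with 0 by ring. now rewrite Rabs_R0.
    - now replace (u + t + - u) with t by ring. }
  destruct c; repeat split; apply K; simpl; (left; ring) || (right; ring).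
Qed.

Lemma locally_translate : forall (x : C2) c (P : C2 -> Prop),
  near x P -> locally 0 (fun t : R => P (translate x (axis c) t)).
Proof.
  intros x c P [e He]. exists e. intros t Ht. apply He, ball_translate.
  replace t with (t + - 0) by ring. exact Ht.
Qed.

(** Symmetry of second derivatives and parallelism of two gradients each involve
    only two coordinate directions at a time, so both are obtained from
    two-variable calculus on these slices. *)
Definition plane (x : C2) (i j : coord) (s t : R) : C2 :=
  translate (translate x (axis i) s) (axis j) t.

Lemma plane_0 : forall x i j, plane x i j 0 0 = x.
Proof. intros. unfold plane. now rewrite !translate_0. Qed.

Lemma locally_2d_plane : forall (x : C2) i j (P : C2 -> Prop),
  near x P -> locally_2d (fun s t => P (plane x i j s t)) 0 0.
Proof.
  intros x i j P [e He]. exists (pos_div_2 e). intros s t Hs Ht.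
  rewrite Rminus_0_r in Hs, Ht. apply He.
  replace (pos e) with (pos_div_2 e + pos_div_2 e) by (simpl; field).
  eapply ball_triangle; apply ball_translate; assumption.
Qed.

Lemma continuity_2d_plane : forall (f : C2 -> R) x i j,
  continuous (f : C * C -> R) x ->
  continuity_2d_pt (fun s t => f (plane x i j s t)) 0 0.
Proof.
  intros f x i j H e.
  apply (locally_2d_plane x i j (fun y => Rabs (f y - f (plane x i j 0 0)) < e)).
  rewrite plane_0. apply (H (fun v => Rabs (v - f x) < e)).
  exists e. intros v Hv. exact Hv.
Qed.

Lemma continuity_2d_plane_at : forall (f : C2 -> R) x i j s t,
  continuous (f : C * C -> R) (plane x i j s t) ->
  continuity_2d_pt (fun s t => f (plane x i j s t)) s t.
Proof.
  intros f x i j s t H e.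
  destruct (continuity_2d_plane f (plane x i j s t) i j H e) as [d Hd].
  rewrite plane_0 in Hd. exists d. intros u v Hu Hv.
  replace (plane x i j u v) with (plane (plane x i j s t) i j (u - s) (v - t)).
  - apply Hd; now rewrite Rminus_0_r.
  - unfold plane.
    rewrite (translate_comm _ (axis j) (axis i)), translate_add, translate_add.
    f_equal; [f_equal|]; ring.
Qed.

(** [pd] and [ex_pd] are anchored at parameter 0; moving the base point along the
    line turns them into derivatives at any parameter of the same line. *)
Lemma is_derive_translate : forall f x c s,
  ex_pd c f (translate x (axis c) s) ->
  is_derive (fun t => f (translate x (axis c) t)) s
    (pd c f (translate x (axis c) s)).
Proof.
  intros f x c s H. apply Derive_correct in H.
  apply (is_derive_ext
    (fun t => f (translate (translate x (axis c) s) (axis c) (t - s)))).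
  { intro t. rewrite translate_add. do 2 f_equal. ring. }
  replace (pd c f (translate x (axis c) s))
    with (scal 1 (pd c f (translate x (axis c) s))) by apply Rmult_1_l.
  apply (is_derive_comp
    (fun t => f (translate (translate x (axis c) s) (axis c) t))
    (fun t => t - s)).
  - replace (s - s) with 0 by ring. exact H.
  - auto_derive; auto.
Qed.

Lemma is_derive_plane_l : forall f x i j s t,
  ex_pd i f (plane x i j s t) ->
  is_derive (fun u => f (plane x i j u t)) s (pd i f (plane x i j s t)).
Proof.
  intros f x i j s t H. unfold plane in *. rewrite translate_comm in *.
  apply (is_derive_ext
    (fun u => f (translate (translate x (axis j) t) (axis i) u))).
  - intro u. now rewrite translate_comm.
  - now apply is_derive_translate.
Qed.

Lemma is_derive_plane_r : forall f x i j s t,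
  ex_pd j f (plane x i j s t) ->
  is_derive (fun u => f (plane x i j s u)) t (pd j f (plane x i j s t)).
Proof. intros. now apply is_derive_translate. Qed.

(** * Smooth functions and their partial derivatives *)

Lemma pd_ext_near : forall c f g x,
  near x (fun y => f y = g y) -> pd c f x = pd c g x.
Proof.
  intros c f g x H. apply Derive_ext_loc.
  exact (locally_translate x c (fun y => f y = g y) H).
Qed.

Lemma ex_pd_ext_near : forall c f g x,
  near x (fun y => f y = g y) -> ex_pd c f x -> ex_pd c g x.
Proof.
  intros c f g x H. apply ex_derive_ext_loc.
  exact (locally_translate x c (fun y => f y = g y) H).
Qed.

Lemma near_open : forall (U : C2 -> Prop) x,
  open (U : C * C -> Prop) -> U x -> near x U.
Proof. intros U x HU Hx. exact (HU x Hx). Qed.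

Lemma continuous_ext_near : forall (f g : C2 -> R) (x : C2),
  near x (fun y => f y = g y) ->
  continuous (f : C * C -> R) x -> continuous (g : C * C -> R) x.
Proof. intros f g x H. apply continuous_ext_loc. 
  apply filter_imp with (2 := H). intros y Hy. now symmetry. Qed.

(** Openness of [U] is what makes this true: the derivatives at a point of [U]
    only see values in [U]. *)
Lemma Ck_on_ext : forall k U f g, open (U : C * C -> Prop) ->
  (forall x, U x -> f x = g x) -> Ck_on k U f -> Ck_on k U g.
Proof.
  induction k as [|k IH]; intros U f g HU E [Hc Hd].
  - split; [|exact I]. intros x Hx.
    apply (continuous_ext_near f g); [|now apply Hc].
    apply filter_imp with (2 := near_open U x HU Hx). exact E.
  - assert (N : forall x, U x -> near x (fun y => f y = g y)).
    { intros x Hx. apply filter_imp with (2 := near_open U x HU Hx). exact E. }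
    split.
    + intros x Hx. apply (continuous_ext_near f g); auto.
    + intro c. destruct (Hd c) as [H1 H2]. split.
      * intros x Hx. apply (ex_pd_ext_near c f g); auto.
      * apply (IH U (pd c f)); auto. intros x Hx. apply pd_ext_near; auto.
Qed.

Lemma Ck_on_S : forall k U f, Ck_on (S k) U f -> Ck_on k U f.
Proof.
  induction k as [|k IH]; intros U f [Hc Hd]; split; auto.
  intro c. destruct (Hd c). split; auto.
Qed.

Lemma Ck_on_subset : forall k (U V : C2 -> Prop) f,
  (forall x, V x -> U x) -> Ck_on k U f -> Ck_on k V f.
Proof.
  induction k as [|k IH]; intros U V f S [Hc Hd]; split; auto.
  intro c. destruct (Hd c). split; auto. now apply (IH U).
Qed.

Lemma pd_const : forall c (a : R) x, pd c (fun _ => a) x = 0.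
Proof. intros. unfold pd. apply Derive_const. Qed.

Lemma Ck_on_const : forall k U (a : R), Ck_on k U (fun _ => a).
Proof.
  induction k as [|k IH]; intros U a; split; auto; try (intros; apply continuous_const).
  intro c. split.
  - intros. exact (@ex_derive_const R_AbsRing R_NormedModule a 0).
  - replace (pd c (fun _ => a)) with (fun _ : C2 => 0); [apply IH|].
    symmetry. apply FunctionalExtensionality.functional_extensionality.
    intro x. apply pd_const.
Qed.

Lemma pd_scal : forall c (a : R) f x, pd c (fun y => a * f y) x = a * pd c f x.
Proof.
  intros. unfold pd. now rewrite Derive_scal.
Qed.

Lemma pd_plus : forall c f g x, ex_pd c f x -> ex_pd c g x ->
  pd c (fun y => f y + g y) x = pd c f x + pd c g x.
Proof. intros c f g x. apply Derive_plus. Qed.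

Lemma pd_mult : forall c f g x, ex_pd c f x -> ex_pd c g x ->
  pd c (fun y => f y * g y) x = pd c f x * g x + f x * pd c g x.
Proof.
  intros c f g x Hf Hg. unfold pd. rewrite Derive_mult; auto.
  now rewrite translate_0.
Qed.

(** The right-hand side is a product of [pd c f], a constant and two copies of
    [/ f], the form that the induction of [Ck_on_inv] needs. *)
Lemma pd_inv : forall c f x, ex_pd c f x -> f x <> 0 ->
  pd c (fun y => / f y) x = (-1 * pd c f x) * (/ f x * / f x).
Proof.
  intros c f x Hf H. unfold pd. rewrite Derive_inv; auto; rewrite translate_0; auto.
  field. auto.
Qed.

Lemma Ck_on_plus : forall k U f g, open (U : C * C -> Prop) ->
  Ck_on k U f -> Ck_on k U g -> Ck_on k U (fun y => f y + g y).
Proof.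
  induction k as [|k IH]; intros U f g HU [Fc Fd] [Gc Gd]; split; auto;
    try (intros; apply (@continuous_plus _ R_AbsRing R_NormedModule); auto).
  intro c. destruct (Fd c) as [F1 F2], (Gd c) as [G1 G2]. split.
  - intros x Hx. exact (@ex_derive_plus R_AbsRing R_NormedModule _ _ 0 (F1 x Hx) (G1 x Hx)).
  - apply (Ck_on_ext k U (fun y => pd c f y + pd c g y)); auto.
    intros x Hx. rewrite pd_plus; auto.
Qed.

Lemma Ck_on_mult : forall k U f g, open (U : C * C -> Prop) ->
  Ck_on k U f -> Ck_on k U g -> Ck_on k U (fun y => f y * g y).
Proof.
  induction k as [|k IH]; intros U f g HU Hf Hg;
    pose proof Hf as [Fc Fd]; pose proof Hg as [Gc Gd]; split; auto;
    try (intros; apply (@continuous_mult _ R_AbsRing); auto).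
  intro c. destruct (Fd c) as [F1 F2], (Gd c) as [G1 G2]. split.
  - intros x Hx. exact (ex_derive_mult _ _ 0 (F1 x Hx) (G1 x Hx)).
  - apply (Ck_on_ext k U (fun y => pd c f y * g y + f y * pd c g y)); auto.
    + intros x Hx. rewrite pd_mult; auto.
    + apply Ck_on_S in Hf, Hg. apply Ck_on_plus; auto.
Qed.

Lemma Ck_on_inv : forall k U f, open (U : C * C -> Prop) ->
  (forall x, U x -> f x <> 0) ->
  Ck_on k U f -> Ck_on k U (fun y => / f y).
Proof.
  induction k as [|k IH]; intros U f HU N Hf; pose proof Hf as [Fc Fd]; split; auto;
    try (intros x Hx; apply continuous_comp with (g := Rinv); auto;
         apply continuous_Rinv; auto).
  intro c. destruct (Fd c) as [F1 F2]. split.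
  - intros x Hx. apply (ex_derive_inv (fun t => f (translate x (axis c) t))).
    + now apply F1.
    + rewrite translate_0. auto.
  - apply Ck_on_S in Hf.
    apply (Ck_on_ext k U (fun y => (-1 * pd c f y) * (/ f y * / f y))); auto.
    + intros x Hx. rewrite pd_inv; auto.
    + apply Ck_on_mult; auto; apply Ck_on_mult; auto. apply Ck_on_const.
Qed.

(** The witnessing open set serves all its points. This allows the remaining
    calculus to be stated at a single point, with no open set in sight. *)
Lemma smooth_near_near : forall f x, smooth_near f x -> near x (smooth_near f).
Proof.
  intros f x (U & HU & Hx & H). apply filter_imp with (2 := near_open U x HU Hx).
  intros y Hy. now exists U.
Qed.

Lemma smooth_near_continuous : forall f x,
  smooth_near f x -> continuous (f : C * C -> R) x.
Proof. intros f x (U & HU & Hx & H). now apply (H O). Qed.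

Lemma smooth_near_ex_pd : forall c f x, smooth_near f x -> ex_pd c f x.
Proof. intros c f x (U & HU & Hx & H). now apply (H 1%nat). Qed.

Lemma smooth_near_pd : forall c f x, smooth_near f x -> smooth_near (pd c f) x.
Proof.
  intros c f x (U & HU & Hx & H). exists U. repeat split; auto.
  intro k. now apply (H (S k)).
Qed.

Lemma smooth_near_const : forall (a : R) x, smooth_near (fun _ => a) x.
Proof.
  intros a x. exists (fun _ => True). repeat split.
  - apply open_true.
  - intro; apply Ck_on_const.
Qed.

Lemma smooth_near_2 : forall (op : (C2 -> R) -> (C2 -> R) -> C2 -> R),
  (forall k U f g, open (U : C * C -> Prop) ->
     Ck_on k U f -> Ck_on k U g -> Ck_on k U (op f g)) ->
  forall f g x, smooth_near f x -> smooth_near g x -> smooth_near (op f g) x.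
Proof.
  intros op Hop f g x (U & HU & Ux & HF) (V & HV & Vx & HG).
  assert (HUV : open (fun y : C * C => U y /\ V y)) by now apply open_and.
  exists (fun y => U y /\ V y). repeat split; auto.
  intro k. apply Hop; auto.
  - apply (Ck_on_subset k U); auto. now intros y [? ?].
  - apply (Ck_on_subset k V); auto. now intros y [? ?].
Qed.

Lemma smooth_near_plus : forall f g x, smooth_near f x -> smooth_near g x ->
  smooth_near (fun y => f y + g y) x.
Proof. exact (smooth_near_2 _ Ck_on_plus). Qed.

Lemma smooth_near_mult : forall f g x, smooth_near f x -> smooth_near g x ->
  smooth_near (fun y => f y * g y) x.
Proof. exact (smooth_near_2 _ Ck_on_mult). Qed.

Lemma near_continuous : forall (f : C2 -> R) (x : C2) (D : R -> Prop),
  continuous (f : C * C -> R) x -> open D -> D (f x) ->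
  near x (fun y => D (f y)).
Proof. intros f x D Hf HD Hx. exact (Hf D (HD _ Hx)). Qed.

(** The open set must shrink to where [f] does not vanish; taking the interior of
    that set inside [U] makes its openness immediate. *)
Lemma smooth_near_inv : forall f x, smooth_near f x -> f x <> 0 ->
  smooth_near (fun y => / f y) x.
Proof.
  intros f x Hf Hx. pose proof Hf as (U & HU & Ux & HF).
  set (V := fun y => near y (fun z => U z /\ f z <> 0)).
  assert (S : forall y, V y -> U y /\ f y <> 0) by (intros y Hy; now apply locally_singleton in Hy).
  assert (OV : open (V : C * C -> Prop)) by (intros y Hy; now apply locally_locally).
  exists V. repeat split; auto.
  - apply filter_and; [now apply HU|].
    apply (near_continuous f x (fun v => v <> 0)); auto.
    + now apply smooth_near_continuous.
    + apply open_neq.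
  - intro k. apply Ck_on_inv; auto.
    + intros y Hy. now apply S.
    + apply (Ck_on_subset k U); auto. intros y Hy. now apply S.
Qed.

Lemma near_and : forall x (P Q : C2 -> Prop), near x P -> near x Q ->
  near x (fun y => P y /\ Q y).
Proof. intros. now apply filter_and. Qed.

Lemma pd_comm : forall c d f x, smooth_near f x ->
  pd d (pd c f) x = pd c (pd d f) x.
Proof.
  intros c d f x Hf.
  pose proof (smooth_near_pd c f x Hf) as Hc.
  pose proof (smooth_near_pd d f x Hf) as Hd.
  set (F := fun s t => f (plane x c d s t)).
  assert (L : locally_2d (fun s t => smooth_near f (plane x c d s t)) 0 0).
  { apply locally_2d_plane. now apply smooth_near_near. }
  assert (D1 : forall s t, smooth_near f (plane x c d s t) ->
     Derive (fun z => F z t) s = pd c f (plane x c d s t)).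
  { intros. apply is_derive_unique, is_derive_plane_l. now apply smooth_near_ex_pd. }
  assert (D2 : forall s t, smooth_near f (plane x c d s t) ->
     Derive (fun z => F s z) t = pd d f (plane x c d s t)).
  { intros. apply is_derive_unique, is_derive_plane_r. now apply smooth_near_ex_pd. }
  assert (L2 : locally_2d (fun s t => 
      is_derive (fun z => Derive (fun t => F z t) t) s (pd c (pd d f) (plane x c d s t)) /\
      is_derive (fun z => Derive (fun t => F t z) s) t (pd d (pd c f) (plane x c d s t))) 0 0).
  { apply locally_2d_locally, locally_locally in L.
    apply locally_2d_locally. revert L. apply filter_imp.
    intros [s t] H; simpl in *. apply (locally_2d_locally (fun s t => smooth_near f (plane x c d s t))) in H.
    pose proof (locally_2d_singleton _ _ _ H) as H0. split.
    - apply (is_derive_ext_loc (fun z => pd d f (plane x c d z t))).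
      + apply locally_2d_1d_const_y in H. revert H. apply filter_imp.
        intros z Hz. now rewrite D2.
      + apply is_derive_plane_l. now apply smooth_near_ex_pd, smooth_near_pd.
    - apply (is_derive_ext_loc (fun z => pd c f (plane x c d s z))).
      + apply locally_2d_1d_const_x in H. revert H. apply filter_imp.
        intros z Hz. now rewrite D1.
      + apply is_derive_plane_r. now apply smooth_near_ex_pd, smooth_near_pd. }
  pose proof (locally_2d_singleton _ _ _ L2) as [E1 E2].
  apply is_derive_unique in E1, E2. rewrite plane_0 in E1, E2.
  rewrite <- E1, <- E2. symmetry. apply Schwarz.
  - generalize (locally_2d_and _ _ _ _ L L2). apply locally_2d_impl, locally_2d_forall.
    intros s t (H & H1 & H2). repeat split.
    + eexists. apply is_derive_plane_l. now apply smooth_near_ex_pd.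
    + eexists. apply is_derive_plane_r. now apply smooth_near_ex_pd.
    + eexists; apply H1.
    + eexists; apply H2.
  - apply (continuity_2d_pt_ext_loc (fun s t => pd c (pd d f) (plane x c d s t))).
    + generalize L2. apply locally_2d_impl, locally_2d_forall.
      intros s t (H1 & H2). symmetry. now apply is_derive_unique.
    + now apply continuity_2d_plane, smooth_near_continuous, smooth_near_pd.
  - apply (continuity_2d_pt_ext_loc (fun s t => pd d (pd c f) (plane x c d s t))).
    + generalize L2. apply locally_2d_impl, locally_2d_forall.
      intros s t (H1 & H2). symmetry. now apply is_derive_unique.
    + now apply continuity_2d_plane, smooth_near_continuous, smooth_near_pd.
Qed.

(** * Functions vanishing on a regular zero set *)

(** Existence and continuity of one partial derivative near the point, with mere
    existence of the other one, already give differentiability. *)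
Lemma differentiable_plane : forall f x i j, smooth_near f x ->
  differentiable_pt_lim (fun s t => f (plane x i j s t)) 0 0 (pd i f x) (pd j f x).
Proof.
  intros f x i j Hf.
  apply filterdiff_differentiable_pt_lim.
  eapply filterdiff_ext_lin.
  - apply (is_derive_filterdiff (fun s t => f (plane x i j s t)) 0 0
      (fun s t => pd i f (plane x i j s t)) (pd j f x)).
    + apply (locally_2d_locally (fun s t =>
        is_derive (fun z => f (plane x i j z t)) s (pd i f (plane x i j s t)))).
      generalize (locally_2d_plane x i j _ (smooth_near_near f x Hf)).
      apply locally_2d_impl, locally_2d_forall.
      intros s t H. now apply is_derive_plane_l, smooth_near_ex_pd.
    + pose proof (is_derive_plane_r f x i j 0 0) as H. rewrite plane_0 in H.
      now apply H, smooth_near_ex_pd.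
    + apply (continuity_2d_pt_filterlim (fun s t => pd i f (plane x i j s t))).
      now apply continuity_2d_plane, smooth_near_continuous, smooth_near_pd.
  - intros [u v]. cbv beta. rewrite plane_0. reflexivity.
Qed.

(** The zero set of [r] has the tangent direction v = (r2, -r1), but no
    parametrisation of it is required. Moving by t along v and by s along the
    gradient n of [r], the first-order expansion of [r] is s |n|^2 + o(t), so [r]
    changes sign as s runs over [-e t, e t]; by the intermediate value theorem it
    vanishes at some such point, hence so does [f]. The expansion of [f] there
    bounds |f1 r2 - f2 r1| by a constant times e. *)
Lemma gradients_parallel_2d : forall (r f : R -> R -> R) (r1 r2 f1 f2 : R),
  differentiable_pt_lim r 0 0 r1 r2 -> differentiable_pt_lim f 0 0 f1 f2 ->
  locally_2d (fun s t => continuity_2d_pt r s t) 0 0 ->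
  r 0 0 = 0 -> locally_2d (fun s t => r s t = 0 -> f s t = 0) 0 0 ->
  f1 * r2 = f2 * r1.
Proof.
  intros r f r1 r2 f1 f2 Dr Df Cr r0 [d0 Z].
  destruct Cr as [dc Cr].
  assert (f0 : f 0 0 = 0).
  { apply Z; auto; rewrite Rminus_0_r, Rabs_R0; apply cond_pos. }
  set (m := Rabs r1 + Rabs r2). set (N := r1 * r1 + r2 * r2).
  set (F := Rabs (f1 * r1 + f2 * r2)).
  destruct (Req_dec N 0) as [N0|N0].
  { assert (r1 = 0) by (unfold N in N0; nra). assert (r2 = 0) by (unfold N in N0; nra).
    subst. ring. }
  assert (Np : 0 < N) by (unfold N in *; nra).
  assert (mp : 0 < m).
  { unfold m. pose proof (Rabs_pos r1). pose proof (Rabs_pos r2).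
    destruct (Req_dec r1 0) as [->|H1].
    - destruct (Req_dec r2 0) as [->|H2]; [unfold N in Np; lra|].
      apply Rabs_pos_lt in H2. lra.
    - apply Rabs_pos_lt in H1. lra. }
  assert (Fp : 0 <= F) by apply Rabs_pos.
  assert (Key : forall e, 0 < e <= 1 -> Rabs (f1 * r2 - f2 * r1) <= e * (F + 2 * m)).
  { intros e [e0 e1].
    assert (h0 : 0 < e * N / (4 * m)) by (apply Rdiv_lt_0_compat; nra).
    destruct (Dr (mkposreal _ h0)) as [d1 D1].
    destruct (Df (mkposreal e e0)) as [d2 D2]. simpl in D1, D2.
    set (d := Rmin (Rmin d0 dc) (Rmin d1 d2)).
    assert (dp : 0 < d) by (repeat apply Rmin_pos; apply cond_pos).
    assert (dle : d <= d0 /\ d <= dc /\ d <= d1 /\ d <= d2).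
    { pose proof (Rmin_l (Rmin d0 dc) (Rmin d1 d2)).
      pose proof (Rmin_r (Rmin d0 dc) (Rmin d1 d2)).
      pose proof (Rmin_l d0 dc). pose proof (Rmin_r d0 dc).
      pose proof (Rmin_l d1 d2). pose proof (Rmin_r d1 d2). fold d in H, H0. lra. }
    set (t := d / (4 * m)).
    assert (tp : 0 < t) by (apply Rdiv_lt_0_compat; lra).
    assert (tm : 2 * m * t < d) by (unfold t; replace (2 * m * (d / (4 * m))) with (d / 2) by (field; lra); lra).
    assert (B : forall s, Rabs s <= e * t ->
       Rabs (t * r2 + s * r1 - 0) <= 2 * m * t /\ Rabs (- t * r1 + s * r2 - 0) <= 2 * m * t).
    { intros s Hs. assert (Hst : Rabs s <= t) by nra.
      rewrite !Rminus_0_r. unfold m.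
      pose proof (Rabs_pos r1). pose proof (Rabs_pos r2). pose proof (Rabs_pos s).
      assert (Et : Rabs t = t) by (apply Rabs_pos_eq; lra).
      split; eapply Rle_trans; try apply Rabs_triang;
        rewrite !Rabs_mult, ?Rabs_Ropp, Et; nra. }
    set (g := fun s => r (t * r2 + s * r1) (- t * r1 + s * r2)).
    assert (G : forall s, Rabs s <= e * t -> Rabs (g s - s * N) <= e * N * t / 2).
    { intros s Hs. destruct (B s Hs) as [B1 B2]. unfold g.
      specialize (D1 (t * r2 + s * r1) (- t * r1 + s * r2)).
      rewrite r0 in D1.
      replace (s * N) with (r1 * (t * r2 + s * r1 - 0) + r2 * (- t * r1 + s * r2 - 0))
        by (unfold N; ring).
      rewrite (Rminus_0_r (r (t * r2 + s * r1) (- t * r1 + s * r2))) in D1.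
      eapply Rle_trans; [apply D1; lra|].
      replace (e * N * t / 2) with (e * N / (4 * m) * (2 * m * t)) by (field; lra).
      apply Rmult_le_compat_l; [lra|]. now apply Rmax_lub. }
    assert (et : 0 < e * t) by nra.
    assert (Hs : exists s, Rabs s <= e * t /\ g s = 0).
    { destruct (Ranalysis5.IVT_interv g (- (e * t)) (e * t)) as [s [Hs1 Hs2]].
      - intros s Hs. assert (As : Rabs s <= e * t) by (apply Rabs_le; lra).
        destruct (B s As) as [B1 B2].
        apply continuity_pt_filterlim.
        change (continuous (fun s => r (t * r2 + s * r1) (- t * r1 + s * r2)) s).
        apply (continuous_comp_2 (fun s : R => t * r2 + s * r1)
          (fun s : R => - t * r1 + s * r2) r).
        + apply (ex_derive_continuous (fun s => t * r2 + s * r1)). auto_derive; auto.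
        + apply (ex_derive_continuous (fun s => - t * r1 + s * r2)). auto_derive; auto.
        + apply (continuity_2d_pt_filterlim r), Cr;
            (eapply Rle_lt_trans; [eassumption | lra]).
      - lra.
      - assert (As : Rabs (- (e * t)) <= e * t) by (rewrite Rabs_Ropp, Rabs_pos_eq; lra).
        apply G in As. apply Rabs_le_between in As. nra.
      - assert (As : Rabs (e * t) <= e * t) by (rewrite Rabs_pos_eq; lra).
        apply G in As. apply Rabs_le_between in As. nra.
      - exists s. split; auto. apply Rabs_le. lra. }
    destruct Hs as [s [Hs gs]]. destruct (B s Hs) as [B1 B2].
    assert (fs : f (t * r2 + s * r1) (- t * r1 + s * r2) = 0) by (apply Z; auto; lra).
    specialize (D2 (t * r2 + s * r1) (- t * r1 + s * r2)).
    rewrite fs, f0 in D2.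
    assert (E : Rabs (t * (f1 * r2 - f2 * r1) + s * (f1 * r1 + f2 * r2)) <= e * (2 * m * t)).
    { rewrite <- Rabs_Ropp.
      replace (- (t * (f1 * r2 - f2 * r1) + s * (f1 * r1 + f2 * r2)))
        with (0 - 0 - (f1 * (t * r2 + s * r1 - 0) + f2 * (- t * r1 + s * r2 - 0))) by ring.
      eapply Rle_trans; [apply D2; lra|].
      apply Rmult_le_compat_l; [lra|]. now apply Rmax_lub. }
    assert (E2 : t * Rabs (f1 * r2 - f2 * r1) <= t * (e * (F + 2 * m))).
    { replace (t * Rabs (f1 * r2 - f2 * r1)) with (Rabs (t * (f1 * r2 - f2 * r1)))
        by (rewrite Rabs_mult, (Rabs_pos_eq t); lra).
      replace (t * (f1 * r2 - f2 * r1)) with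
        ((t * (f1 * r2 - f2 * r1) + s * (f1 * r1 + f2 * r2)) + - (s * (f1 * r1 + f2 * r2))) by ring.
      eapply Rle_trans; [apply Rabs_triang|].
      rewrite Rabs_Ropp, (Rabs_mult s). fold F. nra. }
    now apply Rmult_le_reg_l in E2. }
  apply Rminus_diag_uniq. apply Rabs_eq_0.
  apply Rle_antisym; [|apply Rabs_pos].
  apply le_epsilon. intros e He. rewrite Rplus_0_l.
  pose proof (Rmin_l 1 (e / (F + 2 * m))) as Ha.
  pose proof (Rmin_r 1 (e / (F + 2 * m))) as Hb.
  assert (P : 0 < e / (F + 2 * m)) by (apply Rdiv_lt_0_compat; lra).
  eapply Rle_trans.
  - apply (Key (Rmin 1 (e / (F + 2 * m)))). split; [apply Rmin_pos; lra | lra].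
  - apply Rle_trans with (e / (F + 2 * m) * (F + 2 * m)).
    + apply Rmult_le_compat_r; lra.
    + right. field. lra.
Qed.

(** If [f] were known to be a smooth multiple of [r], this would be the product
    rule; first-order expansions at [x] already give it. *)
Lemma gradients_parallel : forall r f x i j,
  smooth_near r x -> smooth_near f x -> r x = 0 ->
  near x (fun y => r y = 0 -> f y = 0) ->
  pd i f x * pd j r x = pd j f x * pd i r x.
Proof.
  intros r f x i j Hr Hf r0 Z.
  apply (gradients_parallel_2d (fun s t => r (plane x i j s t))
           (fun s t => f (plane x i j s t))).
  - now apply differentiable_plane.
  - now apply differentiable_plane.
  - generalize (locally_2d_plane x i j _ (smooth_near_near r x Hr)).
    apply locally_2d_impl, locally_2d_forall. intros s t H.
    now apply continuity_2d_plane_at, smooth_near_continuous.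
  - now rewrite plane_0.
  - exact (locally_2d_plane x i j _ Z).
Qed.

Definition sum4 (F : coord -> R) : R := F ReZ + F ImZ + F ReW + F ImW.
Definition grad_dot (f g : C2 -> R) (x : C2) : R := sum4 (fun c => pd c f x * pd c g x).

Lemma smooth_near_grad_dot : forall f g x, smooth_near f x -> smooth_near g x ->
  smooth_near (grad_dot f g) x.
Proof.
  intros f g x Hf Hg.
  repeat apply smooth_near_plus; apply smooth_near_mult; now apply smooth_near_pd.
Qed.

Lemma grad_dot_pos : forall f x, grad f x <> (0, 0, 0, 0) -> 0 < grad_dot f f x.
Proof.
  intros f x H. unfold grad_dot, sum4. 
  destruct (Req_dec (pd ReZ f x) 0) as [E1|]; [|nra].
  destruct (Req_dec (pd ImZ f x) 0) as [E2|]; [|nra].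
  destruct (Req_dec (pd ReW f x) 0) as [E3|]; [|nra].
  destruct (Req_dec (pd ImW f x) 0) as [E4|]; [|nra].
  exfalso. apply H. unfold grad. now rewrite E1, E2, E3, E4.
Qed.

Lemma boundary_zero : forall Omega (f : C2 -> R) x,
  near x (fun y => Omega y <-> f y < 0) -> continuous (f : C * C -> R) x ->
  boundary Omega x -> f x = 0.
Proof.
  intros Omega f x HO Hf Hb.
  destruct (Rtotal_order (f x) 0) as [H|[H|H]]; auto; exfalso.
  - destruct (Hb (fun y => (Omega y <-> f y < 0) /\ f y < 0)) as [_ [y [[H1 H2] H3]]].
    + apply near_and; auto. apply (near_continuous f x (fun v => v < 0)); auto. apply open_lt.
    + now apply H3, H1.
  - destruct (Hb (fun y => (Omega y <-> f y < 0) /\ 0 < f y)) as [[y [[H1 H2] H3]] _].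
    + apply near_and; auto. apply (near_continuous f x (fun v => 0 < v)); auto. apply open_gt.
    + apply H1 in H3. lra.
Qed.

Lemma negative_nearby_1d : forall (g : R -> R) l (P : R -> Prop),
  is_derive g 0 l -> l <> 0 -> g 0 = 0 -> locally 0 P -> exists t, P t /\ g t < 0.
Proof.
  intros g l P Hd Hl g0 [e HP].
  apply is_derive_Reals in Hd.
  destruct (Hd (Rabs l) (Rabs_pos_lt l Hl)) as [d D].
  set (h := Rmin e d / 2).
  assert (hp : 0 < h) by (unfold h; pose proof (Rmin_pos e d (cond_pos e) (cond_pos d)); lra).
  assert (he : h < e) by (unfold h in *; pose proof (Rmin_l e d); lra).
  assert (hd : h < d) by (unfold h in *; pose proof (Rmin_r e d); lra).
  assert (S : exists t, Rabs t = h /\ t * l < 0).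
  { destruct (Rtotal_order l 0) as [H|[H|H]]; [|lra|].
    - exists h. split; [rewrite Rabs_pos_eq|]; nra.
    - exists (- h). split; [rewrite Rabs_Ropp, Rabs_pos_eq|]; nra. }
  destruct S as [t [At Tl]].
  assert (t0 : t <> 0) by (intros ->; lra).
  exists t. split.
  - apply HP. change (Rabs (t + - 0) < e). replace (t + - 0) with t by ring. lra.
  - specialize (D t t0). rewrite At, Rplus_0_l, g0, Rminus_0_r in D. specialize (D hd).
    assert (E : Rabs (g t - l * t) < Rabs (l * t)).
    { replace (g t - l * t) with ((g t / t - l) * t) by (field; auto).
      rewrite !Rabs_mult. apply Rmult_lt_compat_r; auto. now apply Rabs_pos_lt. }
    rewrite (Rabs_left (l * t)) in E by lra.
    apply Rabs_lt_between in E. lra.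
Qed.

(** Conversely to [boundary_zero]: a nonzero gradient makes [f] negative at points
    arbitrarily close to [x]. *)
Lemma zero_boundary : forall Omega (f : C2 -> R) x,
  near x (fun y => Omega y <-> f y < 0) -> smooth_near f x ->
  0 < grad_dot f f x -> f x = 0 -> boundary Omega x.
Proof.
  intros Omega f x HO Hf Hd f0 U HU. split.
  - assert (Hc : exists c, pd c f x <> 0).
    { destruct (Req_dec (pd ReZ f x) 0) as [E1|]; [|eexists; eauto].
      destruct (Req_dec (pd ImZ f x) 0) as [E2|]; [|eexists; eauto].
      destruct (Req_dec (pd ReW f x) 0) as [E3|]; [|eexists; eauto].
      destruct (Req_dec (pd ImW f x) 0) as [E4|]; [|eexists; eauto].
      unfold grad_dot, sum4 in Hd. rewrite E1, E2, E3, E4 in Hd. lra. }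
    destruct Hc as [c Hc].
    destruct (negative_nearby_1d (fun t => f (translate x (axis c) t)) (pd c f x)
      (fun t => U (translate x (axis c) t) /\
        (Omega (translate x (axis c) t) <-> f (translate x (axis c) t) < 0)))
      as [t [[H1 H2] H3]]; auto.
    + apply Derive_correct. now apply smooth_near_ex_pd.
    + now rewrite translate_0.
    + apply (locally_translate x c (fun y => U y /\ (Omega y <-> f y < 0))).
      now apply near_and.
    + exists (translate x (axis c) t). split; auto. now apply H2.
  - exists x. split.
    + exact (locally_singleton (x : C * C) U HU).
    + pose proof (locally_singleton (x : C * C) _ HO) as H. cbv beta in H.
      rewrite f0 in H. intro K. apply H in K. lra.
Qed.

(** * Prescribing the 2-jet along the zero set *)

Definition pd2 (c d : coord) (f : C2 -> R) (x : C2) : R := pd c (pd d f) x.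

Lemma smooth_near_pd2 : forall c d f x, smooth_near f x -> smooth_near (pd2 c d f) x.
Proof. intros. now apply smooth_near_pd, smooth_near_pd. Qed.

Lemma smooth_near_sum4 : forall (F : coord -> C2 -> R) x,
  (forall c, smooth_near (F c) x) -> smooth_near (fun y => sum4 (fun c => F c y)) x.
Proof. intros F x H. unfold sum4. now repeat apply smooth_near_plus. Qed.

Lemma pd2_plus : forall c d f g x, smooth_near f x -> smooth_near g x ->
  pd2 c d (fun y => f y + g y) x = pd2 c d f x + pd2 c d g x.
Proof.
  intros c d f g x Hf Hg. unfold pd2.
  rewrite <- pd_plus; try now apply smooth_near_ex_pd, smooth_near_pd.
  apply pd_ext_near.
  generalize (near_and _ _ _ (smooth_near_near f x Hf) (smooth_near_near g x Hg)).
  apply filter_imp. intros y [Fy Gy]. apply pd_plus; now apply smooth_near_ex_pd.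
Qed.

Lemma pd2_scal : forall c d (a : R) f x,
  pd2 c d (fun y => a * f y) x = a * pd2 c d f x.
Proof.
  intros c d a f x. unfold pd2. rewrite <- pd_scal. f_equal.
  apply functional_extensionality. intro y. apply pd_scal.
Qed.

Lemma pd2_mult : forall c d f g x, smooth_near f x -> smooth_near g x ->
  pd2 c d (fun y => f y * g y) x =
  pd2 c d f x * g x + pd c f x * pd d g x + pd d f x * pd c g x + f x * pd2 c d g x.
Proof.
  intros c d f g x Hf Hg. unfold pd2.
  rewrite (pd_ext_near c _ (fun y => pd d f y * g y + f y * pd d g y)).
  - pose proof (smooth_near_pd d f x Hf). pose proof (smooth_near_pd d g x Hg).
    rewrite pd_plus, !pd_mult; try (now apply smooth_near_ex_pd);
      try (now apply smooth_near_ex_pd, smooth_near_mult).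
    ring.
  - generalize (near_and _ _ _ (smooth_near_near f x Hf) (smooth_near_near g x Hg)).
    apply filter_imp. intros y [Fy Gy]. apply pd_mult; now apply smooth_near_ex_pd.
Qed.

(** On {r = 0} the function h r sees only the 1-jet of h, so the first two
    Taylor terms of the quotient rho / r in powers of [r] suffice, and both have
    closed formulas. The zeroth one is h0 = <grad rho, grad r> / |grad r|^2, as
    the gradients are parallel on {r = 0}. The remainder q = rho - h0 r then has
    zero gradient on {r = 0}; its first derivatives vanish there, so each row
    and, by symmetry, each column of its Hessian is proportional to grad r.
    Thus the Hessian of q is 2 g times the tensor square of grad r, with
    2 g = (Hess q)(grad r, grad r) / |grad r|^4, and h = h0 + g r does it. As
    this is built from derivatives, products and inverses, its smoothness is
    clear, which it is not for rho / r. *)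
Lemma jet_factorization : forall r rho p,
  smooth_near r p -> smooth_near rho p -> 0 < grad_dot r r p ->
  near p (fun x => r x = 0 -> rho x = 0) ->
  exists h, smooth_near h p /\
    near p (fun x => r x = 0 ->
      (forall c, pd c rho x = h x * pd c r x) /\
      (forall c d, pd2 c d rho x = pd2 c d (fun y => h y * r y) x)).
Proof.
  intros r rho p Hr Hrho Dp Z.
  assert (Hd : smooth_near (fun y => / grad_dot r r y) p).
  { apply smooth_near_inv; [now apply smooth_near_grad_dot | lra]. }
  set (h0 := fun y => grad_dot rho r y * / grad_dot r r y).
  assert (H0 : smooth_near h0 p) by (apply smooth_near_mult; auto; now apply smooth_near_grad_dot).
  set (q := fun y => rho y + -1 * (h0 y * r y)).
  assert (Hq : smooth_near q p).
  { apply smooth_near_plus; auto. apply smooth_near_mult; [apply smooth_near_const|].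
    now apply smooth_near_mult. }
  set (S := fun y => sum4 (fun c => sum4 (fun d => (pd c r y * pd d r y) * pd2 c d q y))).
  set (g := fun y => / 2 * (S y * (/ grad_dot r r y * / grad_dot r r y))).
  assert (Hg : smooth_near g p).
  { apply smooth_near_mult; [apply smooth_near_const|].
    apply smooth_near_mult; [|now apply smooth_near_mult].
    apply (smooth_near_sum4 (fun c y => sum4 (fun d => (pd c r y * pd d r y) * pd2 c d q y))).
    intro c. apply (smooth_near_sum4 (fun d y => (pd c r y * pd d r y) * pd2 c d q y)).
    intro d. apply smooth_near_mult; [|now apply smooth_near_pd2].
    apply smooth_near_mult; now apply smooth_near_pd. }
  assert (D : near p (fun x => 0 < grad_dot r r x)).
  { apply (near_continuous (grad_dot r r) p (fun v => 0 < v)); auto.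
    - now apply smooth_near_continuous, smooth_near_grad_dot.
    - apply open_gt. }
  assert (W : near p (fun x => (smooth_near r x /\ smooth_near rho x) /\
     (smooth_near h0 x /\ smooth_near q x) /\ smooth_near g x /\ 0 < grad_dot r r x)).
  { repeat apply near_and; auto; now apply smooth_near_near. }
  assert (A2 : near p (fun x => r x = 0 -> forall c, pd c rho x = h0 x * pd c r x)).
  { generalize (near_and _ _ _ W (locally_locally (p : C * C) _ Z)). apply filter_imp.
    intros x [((Rx & Rhox) & _ & _ & Dx) Zx] r0 c.
    assert (E : pd c rho x * grad_dot r r x = grad_dot rho r x * pd c r x).
    { pose proof (fun d => gradients_parallel r rho x c d Rx Rhox r0 Zx) as P.
      unfold grad_dot, sum4.
      replace (pd c rho x * (pd ReZ r x * pd ReZ r x + pd ImZ r x * pd ImZ r x +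
         pd ReW r x * pd ReW r x + pd ImW r x * pd ImW r x)) with
        ((pd c rho x * pd ReZ r x) * pd ReZ r x + (pd c rho x * pd ImZ r x) * pd ImZ r x +
         (pd c rho x * pd ReW r x) * pd ReW r x + (pd c rho x * pd ImW r x) * pd ImW r x) by ring.
      rewrite (P ReZ), (P ImZ), (P ReW), (P ImW). ring. }
    unfold h0. apply Rmult_eq_reg_r with (grad_dot r r x); [|lra]. rewrite E. field. lra. }
  assert (A3 : near p (fun x => r x = 0 -> forall c, pd c q x = 0)).
  { generalize (near_and _ _ _ W A2). apply filter_imp.
    intros x [((Rx & Rhox) & (H0x & _) & _) A] r0 c. unfold q.
    rewrite pd_plus, pd_scal, pd_mult, A, r0; try (now apply smooth_near_ex_pd); auto.
    - ring.
    - apply smooth_near_ex_pd, smooth_near_mult; [apply smooth_near_const|].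
      now apply smooth_near_mult. }
  assert (A4 : near p (fun x => r x = 0 ->
     forall c d, pd2 c d q x = 2 * g x * pd c r x * pd d r x)).
  { generalize (near_and _ _ _ W (locally_locally (p : C * C) _ A3)). apply filter_imp.
    intros x [((Rx & Rhox) & (H0x & Qx) & Gx & Dx) Zx] r0 c d.
    (* The rows of the Hessian of q: [pd b q] vanishes on {r = 0}. *)
    assert (P : forall a b e, pd2 a b q x * pd e r x = pd2 e b q x * pd a r x).
    { intros a b e. apply (gradients_parallel r (pd b q) x a e); auto.
      - now apply smooth_near_pd.
      - revert Zx. apply filter_imp. intros y Hy Ey. now apply Hy. }
    assert (Sy : forall a b, pd2 a b q x = pd2 b a q x) by (intros; now apply pd_comm).
    assert (E : pd2 c d q x * (grad_dot r r x * grad_dot r r x) = S x * pd c r x * pd d r x).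
    { unfold S, grad_dot.
      assert (T : forall a b, pd2 c d q x * (pd a r x * pd b r x) * (pd a r x * pd b r x)
         = pd a r x * pd b r x * pd2 a b q x * pd c r x * pd d r x).
      { intros a b.
        replace (pd2 c d q x * (pd a r x * pd b r x) * (pd a r x * pd b r x))
          with ((pd2 c d q x * pd a r x) * pd b r x * (pd a r x * pd b r x)) by ring.
        rewrite P, (Sy a d).
        replace (pd2 d a q x * pd c r x * pd b r x) with (pd2 d a q x * pd b r x * pd c r x) by ring.
        rewrite P, (Sy b a). ring. }
      transitivity (sum4 (fun a => sum4 (fun b =>
        pd2 c d q x * (pd a r x * pd b r x) * (pd a r x * pd b r x)))).
      - unfold sum4. ring.
      - unfold sum4. rewrite !T. ring. }
    unfold g. apply Rmult_eq_reg_r with (grad_dot r r x * grad_dot r r x); [|nra].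
    rewrite E. field. lra. }
  exists (fun y => h0 y + g y * r y). split.
  { apply smooth_near_plus; auto. now apply smooth_near_mult. }
  generalize (near_and _ _ _ W (near_and _ _ _ A2 A4)). apply filter_imp.
  intros x [((Rx & Rhox) & (H0x & Qx) & Gx & Dx) [E1 E2]] r0. split.
  - intro c. rewrite (E1 r0), r0. ring.
  - intros c d. specialize (E2 r0 c d). unfold q in E2.
    assert (Sm : smooth_near (fun y => h0 y * r y) x) by now apply smooth_near_mult.
    assert (Sg : smooth_near (fun y => g y * r y) x) by now apply smooth_near_mult.
    rewrite pd2_plus, pd2_scal, pd2_mult in E2; auto.
    2: { apply smooth_near_mult; auto. apply smooth_near_const. }
    rewrite pd2_mult; auto; [|now apply smooth_near_plus].
    rewrite !pd_plus; try (now apply smooth_near_ex_pd).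
    rewrite !pd_mult; try (now apply smooth_near_ex_pd).
    rewrite r0 in *. lra.
Qed.

(** * The complex Hessian and the Levi form in real coordinates *)

(** [zz] and [ww] are f_{z zbar} and f_{w wbar}; [zw_re] and [zw_im] are the real
    and imaginary parts of f_{z wbar}. *)
Definition zz (f : C2 -> R) (x : C2) : R := (pd2 ReZ ReZ f x + pd2 ImZ ImZ f x) / 4.
Definition ww (f : C2 -> R) (x : C2) : R := (pd2 ReW ReW f x + pd2 ImW ImW f x) / 4.
Definition zw_re (f : C2 -> R) (x : C2) : R := (pd2 ReW ReZ f x + pd2 ImW ImZ f x) / 4.
Definition zw_im (f : C2 -> R) (x : C2) : R := (pd2 ImW ReZ f x - pd2 ReW ImZ f x) / 4.

Lemma d_z_toC : forall f, d_z (toC f) = fun x => (/ 2 * pd ReZ f x, - / 2 * pd ImZ f x).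
Proof.
  intro f. apply functional_extensionality. intro x. unfold d_z, pdC, toC. simpl. change (fun y : C2 => f y) with f.
  rewrite !pd_const. apply injective_projections; simpl; field.
Qed.

Lemma d_w_toC : forall f, d_w (toC f) = fun x => (/ 2 * pd ReW f x, - / 2 * pd ImW f x).
Proof.
  intro f. apply functional_extensionality. intro x. unfold d_w, pdC, toC. simpl. change (fun y : C2 => f y) with f.
  rewrite !pd_const. apply injective_projections; simpl; field.
Qed.

Lemma d_zbar_toC : forall f x, d_zbar (toC f) x = (/ 2 * pd ReZ f x, / 2 * pd ImZ f x).
Proof.
  intros f x. unfold d_zbar, pdC, toC. simpl. change (fun y : C2 => f y) with f.
  rewrite !pd_const. apply injective_projections; simpl; field.
Qed.

Lemma d_zbar_d_z : forall f x, Re (d_zbar (d_z (toC f)) x) = zz f x.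
Proof.
  intros f x. rewrite d_z_toC. unfold d_zbar, pdC. simpl. rewrite !pd_scal.
  unfold zz, pd2. field.
Qed.

Lemma d_wbar_d_w : forall f x, Re (d_wbar (d_w (toC f)) x) = ww f x.
Proof.
  intros f x. rewrite d_w_toC. unfold d_wbar, pdC. simpl. rewrite !pd_scal.
  unfold ww, pd2. field.
Qed.

Lemma d_wbar_d_z : forall f x, d_wbar (d_z (toC f)) x = (zw_re f x, zw_im f x).
Proof.
  intros f x. rewrite d_z_toC. unfold d_wbar, pdC. simpl. rewrite !pd_scal.
  unfold zw_re, zw_im, pd2. apply injective_projections; simpl; field.
Qed.

(** Symmetry of second derivatives makes this the conjugate of f_{z wbar}, so
    that the Hessian matrix is Hermitian. *)
Lemma d_zbar_d_w : forall f x, smooth_near f x ->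
  d_zbar (d_w (toC f)) x = (zw_re f x, - zw_im f x).
Proof.
  intros f x Hf. rewrite d_w_toC. unfold d_zbar, pdC. simpl. rewrite !pd_scal.
  unfold zw_re, zw_im, pd2.
  rewrite (pd_comm ReZ ReW), (pd_comm ImZ ImW), (pd_comm ReZ ImW), (pd_comm ImZ ReW) by auto.
  apply injective_projections; simpl; field.
Qed.

Lemma Cmod_sqr : forall z : C, Cmod z ^ 2 = fst z ^ 2 + snd z ^ 2.
Proof. intro z. unfold Cmod. apply pow2_sqrt. nra. Qed.

Lemma hessian_det_eq : forall f x,
  hessian_det f x = zz f x * ww f x - (zw_re f x ^ 2 + zw_im f x ^ 2).
Proof.
  intros f x. unfold hessian_det. cbv zeta.
  now rewrite d_zbar_d_z, d_wbar_d_w, d_wbar_d_z, Cmod_sqr.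
Qed.

Lemma levi_eq : forall f x,
  levi f x =
  (zz f x * (pd ReW f x ^ 2 + pd ImW f x ^ 2) + ww f x * (pd ReZ f x ^ 2 + pd ImZ f x ^ 2)
   - 2 * (zw_re f x * (pd ReZ f x * pd ReW f x + pd ImZ f x * pd ImW f x)
          - zw_im f x * (pd ImZ f x * pd ReW f x - pd ReZ f x * pd ImW f x))) / 4.
Proof.
  intros f x. unfold levi. cbv zeta.
  rewrite d_zbar_d_z, d_wbar_d_w, d_wbar_d_z, !Cmod_sqr, d_zbar_toC, d_z_toC, d_w_toC.
  simpl. field.
Qed.

Lemma hessian_form_eq : forall f x (a b : C), smooth_near f x ->
  Re (hessian_form f x a b) =
  zz f x * (fst a ^ 2 + snd a ^ 2) + ww f x * (fst b ^ 2 + snd b ^ 2)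
  + 2 * (zw_re f x * (fst a * fst b + snd a * snd b)
         - zw_im f x * (snd a * fst b - fst a * snd b)).
Proof.
  intros f x [a1 a2] [b1 b2] Hf. rewrite <- d_zbar_d_z, <- d_wbar_d_w.
  unfold hessian_form. cbv zeta.
  rewrite d_wbar_d_z, d_zbar_d_w by auto.
  destruct (d_zbar (d_z (toC f)) x) as [u v], (d_wbar (d_w (toC f)) x) as [u' v'].
  simpl. ring.
Qed.

Lemma hessian_det_nonneg : forall f x, smooth_near f x -> hessian_psd f x ->
  0 <= hessian_det f x.
Proof.
  intros f x Hf H. rewrite hessian_det_eq.
  assert (Q : forall a1 a2 b1 b2, 0 <= zz f x * (a1 ^ 2 + a2 ^ 2) + ww f x * (b1 ^ 2 + b2 ^ 2)
    + 2 * (zw_re f x * (a1 * b1 + a2 * b2) - zw_im f x * (a2 * b1 - a1 * b2))).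
  { intros. specialize (H (a1, a2) (b1, b2)). now rewrite hessian_form_eq in H. }
  clear H. revert Q. generalize (zz f x) (ww f x) (zw_re f x) (zw_im f x).
  intros A D u v Q.
  assert (HA : 0 <= A) by (specialize (Q 1 0 0 0); ring_simplify in Q; lra).
  assert (HD : 0 <= D) by (specialize (Q 0 0 1 0); ring_simplify in Q; lra).
  destruct (Req_dec D 0) as [->|D0].
  - assert (N : u ^ 2 + v ^ 2 <= 0).
    { apply Rnot_lt_le. intro N. set (n := u ^ 2 + v ^ 2) in *.
      (* The vector (t, -B) with B = u + i v and t small compared with |B|^2. *)
      pose proof (Q (n / (A + 1)) 0 (- u) (- v)) as H1.
      assert (t0 : 0 < n / (A + 1)) by (apply Rdiv_lt_0_compat; lra).
      assert (E : n / (A + 1) * (A + 1) = n) by (field; lra).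
      set (t := n / (A + 1)) in *.
      assert (0 <= A * t ^ 2 - 2 * t * n) by (unfold n; nra). nra. }
    lra.
  - (* The vector (D, -B) is in the kernel of the second row of the matrix. *)
    pose proof (Q D 0 (- u) (- v)) as H1.
    assert (0 <= D * (A * D - (u ^ 2 + v ^ 2))) by nra.
    nra.
Qed.

(** Nonnegative determinant and trace make both eigenvalues nonnegative. The proof
    completes squares instead: with B = u + i v, A times the form is the squared
    modulus of A a + conj(B) b plus the determinant times |b|^2. *)
Lemma hessian_psd_intro : forall f x, smooth_near f x ->
  0 <= hessian_det f x -> 0 <= zz f x + ww f x -> hessian_psd f x.
Proof.
  intros f x Hf HD HT a b. rewrite hessian_det_eq in HD. rewrite hessian_form_eq by auto.
  revert HD HT. generalize (zz f x) (ww f x) (zw_re f x) (zw_im f x).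
  destruct a as [a1 a2], b as [b1 b2]. simpl fst. simpl snd.
  intros A D u v HD HT.
  assert (HA : 0 <= A) by nra. assert (HDD : 0 <= D) by nra.
  destruct (Req_dec A 0) as [->|A0].
  - assert (u = 0) by nra. assert (v = 0) by nra. subst. nra.
  - apply Rmult_le_reg_l with A; [lra|]. rewrite Rmult_0_r.
    set (X := A * a1 + u * b1 + v * b2). set (Y := A * a2 + u * b2 - v * b1).
    replace (A * (A * (a1 ^ 2 + a2 ^ 2) + D * (b1 ^ 2 + b2 ^ 2)
      + 2 * (u * (a1 * b1 + a2 * b2) - v * (a2 * b1 - a1 * b2))))
      with (X ^ 2 + Y ^ 2 + (A * D - (u ^ 2 + v ^ 2)) * (b1 ^ 2 + b2 ^ 2))
      by (unfold X, Y; ring).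
    pose proof (pow2_ge_0 X). pose proof (pow2_ge_0 Y).
    pose proof (pow2_ge_0 b1). pose proof (pow2_ge_0 b2). nra.
Qed.

Lemma pd2_mult_zero : forall c d k r x, smooth_near k x -> smooth_near r x -> r x = 0 ->
  pd2 c d (fun y => k y * r y) x =
  k x * pd2 c d r x + pd c k x * pd d r x + pd d k x * pd c r x.
Proof. intros. rewrite pd2_mult, H1; auto. ring. Qed.

(** On {r = 0} the added term M r^2 contributes 2 M times the rank-one matrix of
    dr, which changes the determinant by 2 M times the Hessian form of h r on the
    complex tangent vector (r_w, -r_z). On that vector the cross terms containing
    derivatives of h cancel, which leaves h times the Levi form of r. *)
Lemma hessian_add_square : forall h r M x, smooth_near h x -> smooth_near r x -> r x = 0 ->
  hessian_det (fun y => (h y + M * r y) * r y) x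
    = hessian_det (fun y => h y * r y) x + 2 * M * h x * levi r x /\
  zz (fun y => (h y + M * r y) * r y) x + ww (fun y => (h y + M * r y) * r y) x
    = zz (fun y => h y * r y) x + ww (fun y => h y * r y) x + M / 2 * grad_dot r r x.
Proof.
  intros h r M x Hh Hr r0.
  assert (HM : smooth_near (fun y => M * r y) x).
  { apply smooth_near_mult; auto. apply smooth_near_const. }
  assert (Hk : smooth_near (fun y => h y + M * r y) x) by now apply smooth_near_plus.
  assert (E : forall c, pd c (fun y => h y + M * r y) x = pd c h x + M * pd c r x).
  { intro c. rewrite pd_plus, pd_scal; auto; now apply smooth_near_ex_pd. }
  rewrite !hessian_det_eq, levi_eq. unfold zz, ww, zw_re, zw_im, grad_dot, sum4.
  split; rewrite !pd2_mult_zero by auto; rewrite !E, r0; field.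
Qed.

Lemma hessian_det_opp : forall f x,
  hessian_det (fun y => -1 * f y) x = hessian_det f x.
Proof.
  intros. rewrite !hessian_det_eq. unfold zz, ww, zw_re, zw_im. rewrite !pd2_scal. field.
Qed.

(** * The equivalence *)

(** The witness is h r + M r^2. The first summand of M makes 2 M h at least K near
    p, so that the gain 2 M h L_r in the determinant dominates the deficit K L_r;
    the second makes the gain M |grad r|^2 / 2 in the trace dominate the trace of
    the Hessian of h r. Writing the witness as (h + M r) r with a positive factor
    shows that it defines the same side of the boundary. *)
Lemma psh_from_hessian_bound : forall Omega r p h K,
  near p (fun x => Omega x <-> r x < 0) -> smooth_near r p -> 0 < grad_dot r r p ->
  boundary Omega p -> pseudoconvex_near Omega r p -> smooth_near h p -> 0 < h p -> 0 < K ->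
  near p (fun x => boundary Omega x ->
    - hessian_det (fun y => h y * r y) x <= K * levi r x) ->
  exists rho, local_psh_defining_function Omega p rho.
Proof.
  intros Omega r p h K HO Hr Dp Bp PC Hh hp Kp HB.
  assert (rp : r p = 0).
  { apply (boundary_zero Omega); auto. now apply smooth_near_continuous. }
  set (tau := fun x => zz (fun y => h y * r y) x + ww (fun y => h y * r y) x).
  assert (Htau : smooth_near tau p).
  { unfold tau, zz, ww, Rdiv.
    repeat first [apply smooth_near_plus | apply smooth_near_mult | apply smooth_near_const
      | apply smooth_near_pd2]; auto. }
  set (s := grad_dot r r p) in *.
  set (M := K / h p + 4 * (Rabs (tau p) + 1) / s).
  assert (M1 : K <= M * h p).
  { unfold M. pose proof (Rabs_pos (tau p)).
    replace ((K / h p + 4 * (Rabs (tau p) + 1) / s) * h p)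
      with (K + 4 * (Rabs (tau p) + 1) * h p * / s) by (field; lra).
    assert (0 <= 4 * (Rabs (tau p) + 1) * h p * / s); [|lra].
    apply Rmult_le_pos; [|left; now apply Rinv_0_lt_compat].
    apply Rmult_le_pos; lra. }
  assert (M2 : Rabs (tau p) + 1 <= M * s / 4).
  { unfold M. assert (0 < K / h p) by now apply Rdiv_lt_0_compat.
    replace ((K / h p + 4 * (Rabs (tau p) + 1) / s) * s / 4)
      with (K / h p * s / 4 + (Rabs (tau p) + 1)) by (field; lra). nra. }
  assert (Mp : 0 < M) by nra.
  assert (Hk : smooth_near (fun y => h y + M * r y) p).
  { apply smooth_near_plus; auto. apply smooth_near_mult; auto. apply smooth_near_const. }
  assert (Hd : smooth_near (grad_dot r r) p) by now apply smooth_near_grad_dot.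
  assert (gt : forall (f : C2 -> R) v, smooth_near f p -> v < f p -> near p (fun x => v < f x)).
  { intros f v Hf Hv. apply (near_continuous f p (fun u => v < u)); auto.
    - now apply smooth_near_continuous.
    - apply open_gt. }
  assert (W : near p (fun x => smooth_near r x /\ smooth_near h x /\
    smooth_near (fun y => (h y + M * r y) * r y) x)).
  { repeat apply near_and; apply smooth_near_near; auto. now apply smooth_near_mult. }
  assert (W2 : near p (fun x => h p / 2 < h x /\ s / 2 < grad_dot r r x /\ tau p - 1 < tau x)).
  { repeat apply near_and; apply gt; auto; fold s; lra. }
  assert (W3 : near p (fun x => boundary Omega x -> r x = 0)).
  { generalize (near_and _ _ _ W (locally_locally (p : C * C) _ HO)). apply filter_imp.
    intros x [(Rx & _) Ox]. apply boundary_zero; auto. now apply smooth_near_continuous. }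
  assert (WW := near_and _ _ _ W (near_and _ _ _ W2 W3)).
  exists (fun y => (h y + M * r y) * r y). split; [split; [|split]|].
  - now apply smooth_near_mult.
  - assert (G : near p (fun x => 0 < h x + M * r x)).
    { apply (gt (fun y => h y + M * r y)); auto. rewrite rp. lra. }
    generalize (near_and _ _ _ HO G). apply filter_imp. intros x [Ox Gx].
    rewrite Ox. split; intro H; nra.
  - revert WW. apply filter_imp.
    intros x [(Rx & Hx & Kx) [(h2 & d2 & t2) Z]] Bx E.
    specialize (Z Bx).
    assert (E' : forall c, pd c r x = 0).
    { intro c.
      assert (F : pd c (fun y => (h y + M * r y) * r y) x = 0)
        by (unfold grad in E; injection E as E1 E2 E3 E4; now destruct c).
      rewrite pd_mult in F; try (now apply smooth_near_ex_pd).
      - rewrite Z in F. apply Rmult_eq_reg_l with (h x); lra.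
      - apply smooth_near_ex_pd, smooth_near_plus; auto.
        apply smooth_near_mult; auto. apply smooth_near_const. }
    unfold grad_dot, sum4 in d2. rewrite !E' in d2. lra.
  - generalize (near_and _ _ _ WW (near_and _ _ _ PC HB)). apply filter_imp.
    intros x [[(Rx & Hx & Kx) [(h2 & d2 & t2) Z]] [Lx Bd]] Bx.
    specialize (Z Bx). specialize (Lx Bx). specialize (Bd Bx).
    destruct (hessian_add_square h r M x Hx Rx Z) as [E1 E2].
    apply hessian_psd_intro; auto.
    + rewrite E1. assert (K <= 2 * M * h x) by nra. nra.
    + rewrite E2. fold (tau x). pose proof (Rle_abs (- tau p)) as A. rewrite Rabs_Ropp in A. nra.
Qed.

Theorem theorem1p2 :
  forall (Omega : C2 -> Prop) (r : C2 -> R) (p : C2),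
    is_domain Omega ->
    defining_function Omega r ->
    boundary Omega p ->
    pseudoconvex_near Omega r p ->
    ((exists rho : C2 -> R, local_psh_defining_function Omega p rho)
     <->
     (exists (T : C2 -> R) (K : R),
        0 < K /\
        smooth_near T p /\
        near p (fun x => 1 + T x <> 0) /\
        near p (fun x => boundary Omega x ->
          - hessian_det (fun y => (1 + T y) * r y) x <= K * levi r x))).
Proof.
  intros Omega r p _ [HO HD] Bp PC.
  destruct (HD p Bp) as [Hr Gp]. apply grad_dot_pos in Gp.
  assert (NO : forall x, near x (fun y => Omega y <-> r y < 0)).
  { intro x. apply filter_forall. exact HO. }
  split.
  - intros (rho & (Hrho & NR & GR) & PSH).
    assert (Zr : near p (fun x => r x = 0 -> rho x = 0)).
    { assert (D : near p (fun x => 0 < grad_dot r r x)).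
      { apply (near_continuous (grad_dot r r) p (fun v => 0 < v)); auto.
        - now apply smooth_near_continuous, smooth_near_grad_dot.
        - apply open_gt. }
      generalize (near_and _ _ _ (near_and _ _ _ D (locally_locally (p : C * C) _ NR))
        (near_and _ _ _ (smooth_near_near r p Hr) (smooth_near_near rho p Hrho))).
      apply filter_imp. intros x [[Dx Ox] [Rx Rhox]] r0.
      apply (boundary_zero Omega); auto; [now apply smooth_near_continuous|].
      now apply (zero_boundary Omega r). }
    destruct (jet_factorization r rho p Hr Hrho Gp Zr) as (h & Hh & J).
    assert (BZ : near p (fun x => boundary Omega x -> r x = 0)).
    { generalize (smooth_near_near r p Hr). apply filter_imp.
      intros x Rx. apply boundary_zero; auto. now apply smooth_near_continuous. }
    assert (EQ : (fun y => (1 + (h y + -1)) * r y) = (fun y => h y * r y)).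
    { apply functional_extensionality. intro y. ring. }
    exists (fun y => h y + -1), 1. split; [lra|]. split; [|split].
    + apply smooth_near_plus; auto. apply smooth_near_const.
    + assert (hp : h p <> 0).
      { intro h0. apply (locally_singleton (p : C * C) _ GR Bp).
        destruct (locally_singleton (p : C * C) _ J
          (locally_singleton (p : C * C) _ BZ Bp)) as [J1 _].
        unfold grad. rewrite !J1, h0, !Rmult_0_l. reflexivity. }
      assert (N : near p (fun x => h x <> 0)).
      { apply (near_continuous h p (fun v => v <> 0)); auto.
        - now apply smooth_near_continuous.
        - apply open_neq. }
      revert N. apply filter_imp. intros x Hx. replace (1 + (h x + -1)) with (h x) by ring. auto.
    + rewrite EQ.
      generalize (near_and _ _ _ (near_and _ _ _ J BZ) (near_and _ _ _ (near_and _ _ _ PSH PC)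
        (smooth_near_near rho p Hrho))).
      apply filter_imp. intros x [[Jx Zx] [[Px Lx] Rhox]] Bx.
      destruct (Jx (Zx Bx)) as [_ J2]. specialize (Lx Bx).
      assert (Det : 0 <= hessian_det rho x) by (apply hessian_det_nonneg; auto).
      replace (hessian_det (fun y => h y * r y) x) with (hessian_det rho x); [lra|].
      rewrite !hessian_det_eq. unfold zz, ww, zw_re, zw_im. now rewrite !J2.
  - intros (T & K & Kp & HT & N & HB).
    assert (S1 : smooth_near (fun y => 1 + T y) p).
    { apply smooth_near_plus; auto. apply smooth_near_const. }
    pose proof (locally_singleton (p : C * C) _ N) as Np. cbv beta in Np.
    (* The determinant is even, so a negative multiplier can be replaced by its
       opposite. *)
    destruct (Rdichotomy _ _ Np) as [Neg|Pos].
    + apply (psh_from_hessian_bound Omega r p (fun y => -1 * (1 + T y)) K); auto; [|lra|].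
      * apply smooth_near_mult; auto. apply smooth_near_const.
      * revert HB. apply filter_imp. intros x Hx Bx. specialize (Hx Bx).
        rewrite <- hessian_det_opp in Hx.
        replace (fun y => -1 * (1 + T y) * r y) with (fun y => -1 * ((1 + T y) * r y)); auto.
        apply functional_extensionality. intro y. ring.
    + now apply (psh_from_hessian_bound Omega r p (fun y => 1 + T y) K).
Qed.
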